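(* Let $\Gamma$ be an $n$-player game ($n\ge 2$) with finite pure strategy sets $S_1,\dots,S_n$ and payoff functions $A_1,\dots,A_n$. Consider the optimization problem in the variables $x^i_s,r^i_s,u^i_s,\overline{u}^i,g^i_s\in\mathbb{R}$ and $b^i_s\in\{0,1\}$ ($i\in[n]$, $s\in S_i$): $$\min\ \sum_{i=1}^n\sum_{s\in S_i}\big(g^i_s-(1-b^i_s)\big)$$ subject to $\sum_{s\in S_i}x^i_s=1$ for all $i\in[n]$ and, for all $i\in[n]$ and $s\in S_i$, $$u^i_s=\sum_{\hat{\mathbf{s}}\in S_{-i}}\prod_{s_j\in\hat{\mathbf{s}}}x^j_{s_j}A_i[s,\hat{\mathbf{s}}],\qquad \overline{u}^i\ge u^i_s,\qquad r^i_s=\overline{u}^i-u^i_s,$$ $$r^i_s\le U^i b^i_s,\qquad x^i_s\ge 0,\qquad r^i_s\ge 0,\qquad g^i_s\ge x^i_s,\qquad g^i_s\ge 1-b^i_s.$$ The set of (mixed) Nash equilibria of $\Gamma$ minimizes the objective function of this problem; that is, every Nash equilibrium $\mathbf{x}=(x^i_s)_{i\in[n],s\in S_i}$, together with suitable values of the remaining variables $r^i_s,u^i_s,\overline{u}^i,g^i_s,b^i_s$, is a global minimizer of the problem.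
   Context: Let $[n]=\{1,\dots,n\}$ be the set of players. Player $i$ has a finite set $S_i$ of pure strategies. $S_{-i}=S_1\times\dots\times S_{i-1}\times S_{i+1}\times\dots\times S_n$ is the set of pure strategy tuples of all players other than $i$. The payoff function of player $i$ is $A_i:S_1\times\dots\times S_n\to\mathbb{R}$; for $s\in S_i$ and $\hat{\mathbf{s}}\in S_{-i}$, $A_i[s,\hat{\mathbf{s}}]$ is the payoff of player $i$ when $i$ plays $s$ and the others play $\hat{\mathbf{s}}$. For $\hat{\mathbf{s}}=(s_j)_{j\ne i}\in S_{-i}$, the notation $\prod_{s_j\in\hat{\mathbf{s}}}x^j_{s_j}$ means $\prod_{j\ne i}x^j_{s_j}$. The constant $U^i=\max_{s^l,s^h\in S_i,\ \hat{\mathbf{s}}^l,\hat{\mathbf{s}}^h\in S_{-i}}\big(A_i[s^h,\hat{\mathbf{s}}^h]-A_i[s^l,\hat{\mathbf{s}}^l]\big)$ is the maximum difference of any two payoffs of player $i$. A mixed strategy of player $i$ is a vector $\mathbf{x}^i=(x^i_s)_{s\in S_i}$ with $x^i_s\ge 0$ and $\sum_{s\in S_i}x^i_s=1$ (pure strategies are special cases). A mixed strategy profile is a tuple $\mathbf{x}=(\mathbf{x}^1,\dots,\mathbf{x}^n)$ of mixed strategies; player $i$'s expected payoff is $\mathbb{E}[A_i[\mathbf{x}]]=\sum_{s\in S_i}x^i_s\sum_{\hat{\mathbf{s}}\in S_{-i}}A_i[s,\hat{\mathbf{s}}]\prod_{s_j\in\hat{\mathbf{s}}}x^j_{s_j}$.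 A profile $\mathbf{x}$ is a (mixed) Nash equilibrium if for every player $i$ and every mixed strategy $\mathbf{y}^i$ of player $i$, $\mathbb{E}[A_i[\mathbf{x}]]\ge\mathbb{E}[A_i[\mathbf{y}^i,\mathbf{x}^{-i}]]$, where $(\mathbf{y}^i,\mathbf{x}^{-i})$ is $\mathbf{x}$ with $\mathbf{x}^i$ replaced by $\mathbf{y}^i$. *)

(* Defs.v *)
From HB Require Import structures.
From mathcomp Require Import all_boot all_order all_algebra.
From mathcomp Require Import reals.

Set Implicit Arguments.
Unset Strict Implicit.
Unset Printing Implicit Defensive.

Import Order.TTheory GRing.Theory Num.Theory.
Local Open Scope ring_scope.

Section Game.
Variables (R : realType) (n : nat) (S : 'I_n -> finType).

Definition pure_profile := {dffun forall j : 'I_n, S j}.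

(* S_{-i} *)
Definition others (i : 'I_n) :=
  {dffun forall j : {j : 'I_n | j != i}, S (val j)}.

(* The full profile (s, t) in which i plays s and the others play t. *)
Definition join (i : 'I_n) (s : S i) (t : others i) : pure_profile :=
  [ffun j : 'I_n =>
     match eqVneq j i with
     | EqNotNeq ji => ecast k (S k) (esym ji) s
     | NeqNotEq ji => t (exist _ j ji)
     end : S j].

Definition mixed_profile := forall i : 'I_n, S i -> R.

Definition is_mixed (i : 'I_n) (y : S i -> R) : Prop :=
  (forall s, 0 <= y s) /\ \sum_(s : S i) y s = 1.

Variable A : 'I_n -> pure_profile -> R.

(* Independent of x i: only the strategies of the other players enter. *)
Definition pure_payoff (x : mixed_profile) (i : 'I_n) (s : S i) : R :=
  \sum_(t : others i)
     (\prod_(j : {j : 'I_n | j != i}) x (val j) (t j)) * A i (join s t).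

Definition expected_payoff (x : mixed_profile) (i : 'I_n) : R :=
  \sum_(s : S i) x i s * pure_payoff x s.

(* [dfwith x y] is x with its i-th component replaced by y : S i -> R. *)
Definition nash (x : mixed_profile) : Prop :=
  (forall i, is_mixed (x i)) /\
  forall (i : 'I_n) (y : S i -> R), is_mixed y ->
    expected_payoff (dfwith x y) i <= expected_payoff x i.

(* The default value 0 is harmless: the differences with h = l are 0. *)
Definition payoff_range (i : 'I_n) : R :=
  \big[Num.max/0]_(h : S i * others i) \big[Num.max/0]_(l : S i * others i)
     (A i (join h.1 h.2) - A i (join l.1 l.2)).

(* An assignment of all variables; b is boolean-valued, read as 0/1 in R. *)
Record assignment := Assignment {
  var_x : mixed_profile;
  var_r : forall i : 'I_n, S i -> R;
  var_u : forall i : 'I_n, S i -> R;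
  var_ubar : 'I_n -> R;
  var_g : forall i : 'I_n, S i -> R;
  var_b : forall i : 'I_n, S i -> bool
}.

Definition objective (v : assignment) : R :=
  \sum_(i < n) \sum_(s : S i) (var_g v s - (1 - (var_b v s)%:R)).

Record feasible (v : assignment) : Prop := Feasible {
  sum_x : forall i, \sum_(s : S i) var_x v s = 1;
  u_def : forall i (s : S i), var_u v s = pure_payoff (var_x v) s;
  ubar_ge : forall i (s : S i), var_u v s <= var_ubar v i;
  r_def : forall i (s : S i), var_r v s = var_ubar v i - var_u v s;
  r_le : forall i (s : S i), var_r v s <= payoff_range i * (var_b v s)%:R;
  x_ge0 : forall i (s : S i), 0 <= var_x v s;
  r_ge0 : forall i (s : S i), 0 <= var_r v s;
  g_ge_x : forall i (s : S i), var_x v s <= var_g v s;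
  g_ge_b : forall i (s : S i), 1 - (var_b v s)%:R <= var_g v s
}.

Definition global_minimizer (v : assignment) : Prop :=
  feasible v /\ forall w, feasible w -> objective v <= objective w.

End Game.

(* Main.v *)
(* Feasibility forces every summand of the objective to be nonnegative, so it
   suffices that an equilibrium attains the value 0. Take ubar the equilibrium
   payoff, b = 1 exactly on the pure strategies that are not best responses, and
   g = 1 - b; then g >= x holds because strategies that are not best responses
   carry no probability. The bound r <= U b holds because ubar is a convex
   combination of pure payoffs, any two of which differ by at most U. *)
Require Import Defs.
From HB Require Import structures.
From mathcomp Require Import all_boot all_order all_algebra.
From mathcomp Require Import reals.

Set Implicit Arguments.
Unset Strict Implicit.
Unset Printing Implicit Defensive.

Import Order.TTheory GRing.Theory Num.Theory.
Local Open Scope ring_scope.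

(** Distributivity for index types varying with [i]. It serves to show that the product weights of
    the opponents sum to 1. *)
Lemma sum_dffun_prod (R : comNzRingType) (I : finType) (T : I -> finType)
    (F : forall i, T i -> R) :
  \sum_(t : {dffun forall i, T i}) \prod_i F i (t i) = \prod_i \sum_s F i s.
Proof.
rewrite (reindex (@dffun_of_fprod I T)); last exact/onW_bij/dffun_of_fprod_bij.
pose G i := [ffun s => F i s].
transitivity (\sum_(t : fprod T) \prod_i G i (t i)).
  by apply: eq_bigr => t _; apply: eq_bigr => i _; rewrite !ffunE.
(* Dependent functions become families of tagged elements, all of one type. The default 0 of [untag]
   is never reached, since the [i]-th element carries tag [i]. *)
rewrite (@big_fprod _ _ _ _ _ _ _ G) -(bigA_distr_big_dep _ (fun i s => untag 0 (G i) s)).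
apply: eq_bigr => i _; rewrite -(big_tag (fun i s => G i s)).
by apply: eq_bigr => s _; rewrite ffunE.
Qed.

Lemma sum_delta (R : nzRingType) (T : finType) (s : T) (F : T -> R) :
  \sum_t (t == s)%:R * F t = F s.
Proof.
rewrite (bigD1 s) //= eqxx mul1r big1 ?addr0 // => t /negPf ->.
by rewrite mul0r.
Qed.

Section Game.
Variables (R : realType) (n : nat) (S : 'I_n -> finType).
Variables (A : 'I_n -> pure_profile S -> R) (x : mixed_profile R S).

Lemma is_mixed_pure i (s : S i) : is_mixed (fun t : S i => (t == s)%:R : R).
Proof.
split=> [t|]; first exact: ler0n.
by rewrite -[RHS](sum_delta s (fun=> 1)); under [RHS]eq_bigr do rewrite mulr1.
Qed.

Lemma is_mixed_le1 i (y : S i -> R) s : is_mixed y -> y s <= 1.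
Proof.
by case=> y0 <-; rewrite (bigD1 s) //= lerDl sumr_ge0.
Qed.

Lemma pure_payoff_dfwith i (y : S i -> R) (s : S i) :
  pure_payoff A (dfwith x y) s = pure_payoff A x s.
Proof.
apply: eq_bigr => t _; congr (_ * _); apply: eq_bigr => j _.
by rewrite dfwith_out // eq_sym (valP j).
Qed.

Lemma expected_payoff_dfwith i (y : S i -> R) :
  expected_payoff A (dfwith x y) i = \sum_s y s * pure_payoff A x s.
Proof. by apply: eq_bigr => s _; rewrite pure_payoff_dfwith dfwith_in. Qed.

Lemma le_payoff_range i (s s' : S i) (t t' : others S i) :
  A i (join s t) - A i (join s' t') <= payoff_range A i.
Proof.
apply: le_trans (le_bigmax _ _ (s, t)).
exact: (le_bigmax _ (fun l => A i (join s t) - A i (join l.1 l.2)) (s', t')).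
Qed.

Hypothesis mixed_x : forall i, is_mixed (@x i).

(** Both payoffs average over the same product distribution on [others S i], so their difference
    averages payoff differences, each bounded by the range. *)
Lemma pure_payoffB_le i (s s' : S i) :
  pure_payoff A x s - pure_payoff A x s' <= payoff_range A i.
Proof.
have w1 : \sum_(t : others S i) \prod_j x (t j) = 1.
  rewrite (sum_dffun_prod (fun j : {j | j != i} => @x (val j))).
  by apply: big1 => j _; case: (mixed_x (val j)).
rewrite -sumrB -[leRHS]mul1r -[X in _ <= X * _]w1 mulr_suml; apply: ler_sum => t _.
rewrite -mulrBr ler_wpM2l ?le_payoff_range // prodr_ge0 // => j _.
by case: (mixed_x (val j)).
Qed.

Lemma expected_payoffB i (c : R) :
  expected_payoff A x i - c = \sum_s x s * (pure_payoff A x (i := i) s - c).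
Proof.
under eq_bigr do rewrite mulrBr.
by rewrite sumrB -mulr_suml (mixed_x i).2 mul1r.
Qed.

Lemma expected_payoffB_le i (s : S i) :
  expected_payoff A x i - pure_payoff A x s <= payoff_range A i.
Proof.
rewrite expected_payoffB -[leRHS]mul1r -(mixed_x i).2 mulr_suml.
by apply: ler_sum => t _; rewrite ler_wpM2l ?pure_payoffB_le ?(mixed_x i).1.
Qed.

End Game.

Section Equilibrium.
Variables (R : realType) (n : nat) (S : 'I_n -> finType).
Variables (A : 'I_n -> pure_profile S -> R) (x : mixed_profile R S).
Hypothesis nash_x : nash A x.

(** Apply the equilibrium condition to the deviation to the point mass at [s]. *)
Lemma nash_pure_payoff_le i (s : S i) :
  pure_payoff A x s <= expected_payoff A x i.
Proof.
have := nash_x.2 i _ (is_mixed_pure R s).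
by rewrite expected_payoff_dfwith sum_delta.
Qed.

(** The gaps to the equilibrium payoff, weighted by [x], are nonnegative and sum to 0, so each
    weighted gap vanishes. *)
Lemma nash_support i (s : S i) :
  pure_payoff A x s < expected_payoff A x i -> x s = 0.
Proof.
move=> lt_s; have mx := nash_x.1.
have gap_ge0 (t : S i) : true ->
    0 <= x t * (expected_payoff A x i - pure_payoff A x t).
  by move=> _; rewrite mulr_ge0 ?(mx i).1 // subr_ge0 nash_pure_payoff_le.
have gap0 : \sum_(t : S i)
    x t * (expected_payoff A x i - pure_payoff A x t) = 0.
  (* Up to sign, this is [expected_payoffB] with [c] the expected payoff itself. *)
  apply: oppr_inj; rewrite -sumrN; under eq_bigr do rewrite -mulrN opprB.
  by rewrite -(expected_payoffB A mx) subrr oppr0.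
have /eqP := psumr_eq0P gap_ge0 gap0 (i := s) isT.
by rewrite mulf_eq0 subr_eq0 (gt_eqF lt_s) orbF => /eqP.
Qed.

Definition nash_assignment : assignment R S :=
  let b i (s : S i) := pure_payoff A x s < expected_payoff A x i in
  {| var_x := x;
     var_r := fun i s => expected_payoff A x i - pure_payoff A x s;
     var_u := fun i s => pure_payoff A x s;
     var_ubar := fun i => expected_payoff A x i;
     var_g := fun i s => 1 - (b i s)%:R;
     var_b := b |}.

Lemma nash_assignment_feasible : feasible A nash_assignment.
Proof.
have mx := nash_x.1.
split=> //= i => [|s|s|s|s|s]; first exact: (mx i).2.
- exact: nash_pure_payoff_le.
- case: ltP => [_|le_s]; first by rewrite mulr1 expected_payoffB_le.
  by rewrite mulr0 subr_le0.
- exact: (mx i).1.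
- by rewrite subr_ge0 nash_pure_payoff_le.
(* For [b = 1], both [g] and [x] are 0; for [b = 0], [g] is 1 and bounds any probability. *)
- case: ltP => [/nash_support -> | _]; first by rewrite subrr.
  by rewrite subr0; exact: (is_mixed_le1 s (mx i)).
Qed.

Lemma nash_assignment_objective : objective nash_assignment = 0.
Proof. by apply: big1 => i _; apply: big1 => s _; rewrite subrr. Qed.

End Equilibrium.

Lemma objective_ge0 (R : realType) (n : nat) (S : 'I_n -> finType)
    (A : 'I_n -> pure_profile S -> R) (w : assignment R S) :
  feasible A w -> 0 <= objective w.
Proof.
move=> fw; apply: sumr_ge0 => i _; apply: sumr_ge0 => s _.
by rewrite subr_ge0 (g_ge_b fw).
Qed.

Theorem proposition5 (R : realType) (n : nat) (hn : (2 <= n)%N)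
    (S : 'I_n -> finType) (A : 'I_n -> pure_profile S -> R)
    (x : mixed_profile R S) :
  nash A x ->
  exists v : assignment R S, var_x v = x /\ global_minimizer A v.
Proof.
move=> nash_x; exists (nash_assignment A x); split=> //.
split=> [|w fw]; first exact: nash_assignment_feasible.
by rewrite nash_assignment_objective (objective_ge0 fw).
Qed.
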